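(* Let $M,A\in\mathbb{R}^{d\times d}$, and let $\sigma$ be the smallest singular value of $M$. In two dimensions ($d=2$), $$\Big(\mathrm{sgn}(\det(A))\,\mathrm{cof}(A)-\mathrm{sgn}(\det(M))\,\mathrm{cof}(M)\Big):(A-M)\ \ge\ -\frac{|\det(M)|}{\sigma^2}\,|A-M|^2 .$$ In three dimensions ($d=3$), $$\Big(\mathrm{sgn}(\det(A))\,\mathrm{cof}(A)-\mathrm{sgn}(\det(M))\,\mathrm{cof}(M)\Big):(A-M)\ \ge\ -\Big(1+\tfrac32(1+\sqrt3)\Big)\frac{|\det(M)|}{\sigma^2}\,|A-M|^2 .$$
   Context: $\mathrm{cof}(M)$ is the cofactor matrix, $M^T\mathrm{cof}(M)=\det(M)I$; $A:B=\mathrm{tr}(A^TB)$; $|\cdot|$ applied to a matrix is the Frobenius norm; $\mathrm{sgn}$ is the sign function. *)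

(* Defs.v *)
From mathcomp Require Import all_boot all_order all_algebra.
From mathcomp Require Import reals.

Set Implicit Arguments.
Unset Strict Implicit.
Unset Printing Implicit Defensive.

Import GRing.Theory Num.Theory.
Local Open Scope ring_scope.

(* Mathcomp's adjugate is the transpose of this matrix. *)
Definition cof (R : comNzRingType) (d : nat) (M : 'M[R]_d) : 'M[R]_d :=
  \matrix_(i < d, j < d) cofactor M i j.

Lemma trmx_mul_cof (R : comNzRingType) (d : nat) (M : 'M[R]_d) :
  M^T *m cof M = (\det M)%:M.
Proof.
rewrite -[LHS]trmxK trmx_mul trmxK.
have -> : (cof M)^T = \adj M by apply/matrixP => i j; rewrite !mxE.
by rewrite mul_adj_mx tr_scalar_mx.
Qed.

Definition frob_prod (R : comNzRingType) (d : nat) (A B : 'M[R]_d) : R :=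
  \tr (A^T *m B).

Definition frob_norm (R : rcfType) (d : nat) (A : 'M[R]_d) : R :=
  Num.sqrt (\sum_(i < d) \sum_(j < d) A i j ^+ 2).

Definition singular_value (R : rcfType) (d : nat) (M : 'M[R]_d) (s : R) : Prop :=
  0 <= s /\ eigenvalue (M^T *m M) (s ^+ 2).

Definition smallest_singular_value (R : rcfType) (d : nat) (M : 'M[R]_d)
    (sigma : R) : Prop :=
  singular_value M sigma /\
  forall s : R, singular_value M s -> sigma <= s.

(* Main.v *)
(* Substitute A = M (1 + X).  Since sgn(det B) adj B = |det B| B^-1 for
   invertible B, the left-hand side becomes |det M| times the same expression
   with M replaced by the identity, namely
     sgn(det(1 + X)) tr(adj(1 + X) X) - tr X,
   and |A - M| = |M X| >= sigma |X| by the Rayleigh quotient bound for M^T M.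
   It remains to bound this scalar below by -k |X|^2 for each sign of
   det(1 + X).  For d = 3 and det(1 + X) > 0 it equals
   2 tr(adj X) + 3 det X; small X is handled by det X >= -|X|^2, valid for
   |X| <= 2, and large X by det X > -1 - tr X - tr(adj X). *)
Require Import Defs.
From mathcomp Require Import all_boot all_order all_algebra.
From mathcomp Require Import reals ring lra.
From mathcomp Require Import complex.

Set Implicit Arguments.
Unset Strict Implicit.
Unset Printing Implicit Defensive.

Import Order.TTheory GRing.Theory Num.Theory.
Local Open Scope ring_scope.
Local Open Scope sesquilinear_scope.

(* The spectral theorem is available only over closed fields, hence the passage
   to R[i]. *)
Lemma rayleigh_ge (R : rcfType) d (S : 'M[R]_d) (c : R) :
  S^T = S -> (forall a, eigenvalue S a -> c <= a) ->
  forall u : 'rV[R]_d, c * (u *m u^T) 0 0 <= (u *m S *m u^T) 0 0.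
Proof.
move=> Ssym c_min u.
pose f := [the {rmorphism R -> R[i]} of real_complex R].
pose SC := map_mx f S.
have fJ n m (A : 'M[R]_(n, m)) : (map_mx f A)^t* = map_mx f A^T.
  by apply/matrixP => i j; rewrite !mxE /=; apply: conjc_real.
have SCherm : SC \is hermsymmx.
  apply: realsym_hermsym.
    apply/is_hermitianmxP; rewrite expr0 scale1r map_mx_id //.
    by rewrite /SC map_trmx Ssym.
  by apply/mxOverP => i j; rewrite mxE; apply/complex_realP; exists (S i j).
have spR := hermitian_spectral_diag_real SCherm.
have /orthomx_spectralP SCE := hermitian_normalmx SCherm.
set P := spectralmx SC in SCE; set sp := spectral_diag SC in SCE spR.
have Punit : P \is unitarymx := spectral_unitarymx SC.
have PSC : P *m SC = diag_mx sp *m P.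
  by rewrite SCE -mulmxA mulKVmx // unitarymx_unit.
(* Row [j] of [P] is an eigenvector whose eigenvalue is real; [eigenvalue_map] brings that
   eigenvalue down to [R], where [c_min] applies. *)
have sp_ge j : f c <= sp 0 j.
  have /mxOverP/(_ 0 j)/complex_realP[a spa] := spR.
  rewrite spa lecR; apply: c_min.
  rewrite -(eigenvalue_map f).
  apply/eigenvalueP; exists (row j P).
    rewrite -row_mul PSC mul_diag_mx.
    by apply/rowP => k; rewrite !mxE spa.
  apply: contraTneq (unitarymx_unit Punit) => Pj0.
  by rewrite -row_free_unit; apply/row_freePn; exists j; rewrite Pj0 sub0mx.
(* Coordinates of [u] in the eigenbasis, which diagonalize both quadratic forms. *)
pose w := map_mx f u *m P^t*.
have uuE : f ((u *m u^T) 0 0) = \sum_j `|w 0 j| ^+ 2.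
  have -> : \sum_j `|w 0 j| ^+ 2 = (w *m w^t*) 0 0.
    by rewrite mxE; apply: eq_bigr => j _; rewrite normCK !mxE.
  rewrite /w trmx_mul map_mxM trmxCK mulmxA.
  by rewrite mulmxKtV // fJ -map_mxM [RHS]mxE.
have uSuE : f ((u *m S *m u^T) 0 0) = \sum_j sp 0 j * `|w 0 j| ^+ 2.
  have -> : \sum_j sp 0 j * `|w 0 j| ^+ 2 = (w *m diag_mx sp *m w^t*) 0 0.
    rewrite mxE; apply: eq_bigr => j _.
    by rewrite mul_mx_diag normCK !mxE mulrCA mulrA.
  rewrite /w trmx_mul map_mxM trmxCK -!mulmxA.
  rewrite (mulmxA (diag_mx sp)) -PSC fJ -invmx_unitary // -(mulmxA P).
  by rewrite mulKmx ?unitarymx_unit // -!map_mxM [RHS]mxE.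
have fle x y : (x <= y) = (f x <= f y) by rewrite lecR.
by rewrite fle rmorphM uuE uSuE mulr_sumr ler_sum // => j _;
   rewrite ler_wpM2r ?exprn_ge0.
Qed.

(** * Singular values and the Frobenius norm *)

Lemma frob_normE (R : rcfType) d (A : 'M[R]_d) :
  frob_norm A ^+ 2 = \sum_(i < d) \sum_(j < d) A i j ^+ 2.
Proof.
by rewrite sqr_sqrtr //; do 2![apply: sumr_ge0 => ? _]; apply: sqr_ge0.
Qed.

Lemma mul_tr_ge0 (R : rcfType) d (u : 'rV[R]_d) : 0 <= (u *m u^T) 0 0.
Proof. by rewrite mxE sumr_ge0 // => j _; rewrite mxE -expr2 sqr_ge0. Qed.

Lemma mul_tr_gt0 (R : rcfType) d (u : 'rV[R]_d) :
  u != 0 -> 0 < (u *m u^T) 0 0.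
Proof.
move=> u0; rewrite lt_def mul_tr_ge0 andbT; apply: contra u0 => /eqP.
rewrite mxE => /psumr_eq0P uu0; apply/eqP/rowP => j; apply/eqP.
rewrite mxE -sqrf_eq0 expr2.
have := uu0 _ j isT; rewrite mxE => -> // k _.
by rewrite mxE -expr2 sqr_ge0.
Qed.

(** An eigenvector [v] satisfies [a |v|^2 = |v M^T|^2]. *)
Lemma eigenvalue_trmul_ge0 (R : rcfType) d (M : 'M[R]_d) a :
  eigenvalue (M^T *m M) a -> 0 <= a.
Proof.
case/eigenvalueP => v vE v0; rewrite -(pmulr_lge0 _ (mul_tr_gt0 v0)).
have -> : a * (v *m v^T) 0 0 = ((v *m M^T) *m (v *m M^T)^T) 0 0.
  by rewrite trmx_mul trmxK mulmxA -(mulmxA v) vE -scalemxAl [RHS]mxE.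
exact: mul_tr_ge0.
Qed.

(** Since [a] is nonnegative, its square root is a singular value. *)
Lemma smallest_singular_value_le_eigen (R : rcfType) d (M : 'M[R]_d) sigma a :
  smallest_singular_value M sigma ->
  eigenvalue (M^T *m M) a -> sigma ^+ 2 <= a.
Proof.
move=> [[s0 _] smin] ea; have a0 := eigenvalue_trmul_ge0 ea.
rewrite -(sqr_sqrtr a0) lerXn2r ?nnegrE ?sqrtr_ge0 //.
by apply: smin; split; rewrite ?sqrtr_ge0 ?sqr_sqrtr.
Qed.

(** A singular [M] would make 0 an eigenvalue of [M^T *m M], forcing [sigma = 0]. *)
Lemma smallest_singular_value_unit (R : rcfType) d (M : 'M[R]_d) sigma :
  smallest_singular_value M sigma -> sigma != 0 -> M \in unitmx.
Proof.
move=> sM s0; apply: contraT; rewrite unitmxE unitfE negbK => /eqP dM.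
have /eqP/det0P[v v0 vS] : \det (M^T *m M) = 0 by rewrite det_mulmx dM mulr0.
have e0 : eigenvalue (M^T *m M) 0.
  by apply/eigenvalueP; exists v; rewrite // vS scale0r.
have := smallest_singular_value_le_eigen sM e0.
by rewrite leNgt exprn_even_gt0 // s0.
Qed.

(** The Rayleigh bound is applied to each column of [X]. *)
Lemma frob_norm_mul_ge (R : rcfType) d (M X : 'M[R]_d) sigma :
  smallest_singular_value M sigma ->
  sigma ^+ 2 * frob_norm X ^+ 2 <= frob_norm (M *m X) ^+ 2.
Proof.
move=> sM.
have colE (Y : 'M[R]_d) :
    frob_norm Y ^+ 2 = \sum_j ((row j Y^T) *m (row j Y^T)^T) 0 0.
  rewrite frob_normE exchange_big; apply: eq_bigr => j _.
  by rewrite mxE; apply: eq_bigr => i _; rewrite !mxE expr2.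
rewrite !colE mulr_sumr; apply: ler_sum => j _.
rewrite trmx_mul row_mul trmx_mul trmxK mulmxA -(mulmxA _ M^T).
apply: rayleigh_ge; first by rewrite trmx_mul trmxK.
by move=> a; apply: smallest_singular_value_le_eigen.
Qed.

(** * Reduction to perturbations of the identity *)

Lemma cof_tr (R : comNzRingType) d (A : 'M[R]_d) : (cof A)^T = \adj A.
Proof. by apply/matrixP => i j; rewrite !mxE. Qed.

Lemma sg_adj_mul (R : realFieldType) d (A : 'M[R]_d) :
  A \in unitmx -> Num.sg (\det A) *: \adj A = `|\det A| *: invmx A.
Proof.
move=> uA; rewrite /invmx uA scalerA normrEsg -mulrA divff ?mulr1 //.
by rewrite -unitfE -unitmxE.
Qed.

Lemma frob_prod_sg_cof (R : realFieldType) d (M X : 'M[R]_d) :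
  M \in unitmx ->
  frob_prod (Num.sg (\det (M *m (1%:M + X))) *: cof (M *m (1%:M + X))
             - Num.sg (\det M) *: cof M) (M *m X) =
  `|\det M| *
    (Num.sg (\det (1%:M + X)) * \tr (\adj (1%:M + X) *m X) - \tr X).
Proof.
move=> uM; set B := 1%:M + X.
rewrite /frob_prod [(_ - _)^T]raddfB /= ![(_ *: _)^T]linearZ /= !cof_tr.
rewrite mulmxBl [\tr (_ - _)]raddfB /=.
rewrite mulrBr; congr (_ - _); last first.
  by rewrite sg_adj_mul // -scalemxAl mulKmx // linearZ.
(* For singular [B] the sign factor is 0 on both sides. *)
have [uB|nuB] := boolP (B \in unitmx); last first.
  have dB : \det B = 0.
    by apply/eqP; move: nuB; rewrite unitmxE unitfE negbK.
  by rewrite det_mulmx dB mulr0 sgr0 scale0r mul0mx mul0r mulr0 linear0.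
rewrite sg_adj_mul ?unitmx_mul ?uM // det_mulmx normrM.
have -> : invmx (M *m B) = invmx B *m invmx M.
  apply: (can_inj (mulKmx (_ : M *m B \in unitmx))).
    by rewrite unitmx_mul uM.
  rewrite mulmxV ?unitmx_mul ?uM // mulmxA -(mulmxA M) mulmxV // mulmx1.
  by rewrite mulmxV.
(* The factor [invmx M] cancels against [M *m X]. *)
rewrite -scalemxAl -mulmxA mulKmx // linearZ /= -mulrA; congr (_ * _).
by rewrite -!mxtraceZ !scalemxAl sg_adj_mul.
Qed.

Lemma lower_bound_of_relative (R : rcfType) d (M A : 'M[R]_d) (sigma k : R) :
  0 <= k -> smallest_singular_value M sigma -> sigma != 0 ->
  (forall X : 'M[R]_d,
    - (k * frob_norm X ^+ 2) <=
    Num.sg (\det (1%:M + X)) * \tr (\adj (1%:M + X) *m X) - \tr X) ->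
  - (k * (`|\det M| / sigma ^+ 2) * frob_norm (A - M) ^+ 2) <=
  frob_prod (Num.sg (\det A) *: cof A - Num.sg (\det M) *: cof M) (A - M).
Proof.
move=> k0 sM s0 bound; have uM := smallest_singular_value_unit sM s0.
pose X := invmx M *m (A - M).
have EX : A - M = M *m X by rewrite mulKVmx.
have AX : A = M *m (1%:M + X) by rewrite mulmxDr mulmx1 -EX addrC subrK.
rewrite EX AX frob_prod_sg_cof //.
apply: le_trans (ler_wpM2l (normr_ge0 _) (bound X)).
have s2 : 0 < sigma ^+ 2 by rewrite exprn_even_gt0 // s0.
rewrite mulrN lerN2 mulrCA -!mulrA ler_wpM2l // ler_wpM2l // ler_pdivlMl //.
exact: frob_norm_mul_ge.
Qed.

(** * Determinant and adjugate identities *)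

Lemma tr_adj_mul (R : comNzRingType) d (X : 'M[R]_d) :
  \tr (\adj (1%:M + X) *m X) =
  \det (1%:M + X) *+ d - \tr (\adj (1%:M + X)).
Proof.
set B := 1%:M + X.
have -> : X = B - 1%:M by rewrite addrC addKr.
by rewrite mulmxBr mulmx1 mul_adj_mx linearB /= mxtrace_scalar.
Qed.

Lemma det_mx22 (R : comNzRingType) (A : 'M[R]_2) :
  \det A = A ord0 ord0 * A ord_max ord_max - A ord0 ord_max * A ord_max ord0.
Proof.
rewrite (expand_det_row _ ord0) !big_ord_recl big_ord0 /cofactor !det_mx11 !mxE.
have -> : lift (lift ord0 ord0 : 'I_2) ord0 = ord0 by apply: val_inj.
have -> : lift ord0 ord0 = ord_max :> 'I_2 by apply: val_inj.
by rewrite /=; ring.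
Qed.

Section Matrix33.
Variables (R : comNzRingType) (A : 'M[R]_3) (a : nat -> nat -> R).
Hypothesis AE : forall i j, A i j = a i j.

Lemma det_mx33 : \det A =
    a 0%N 0%N * (a 1%N 1%N * a 2%N 2%N - a 1%N 2%N * a 2%N 1%N)
  + a 0%N 1%N * (a 1%N 2%N * a 2%N 0%N - a 1%N 0%N * a 2%N 2%N)
  + a 0%N 2%N * (a 1%N 0%N * a 2%N 1%N - a 1%N 1%N * a 2%N 0%N).
Proof.
rewrite (expand_det_row _ ord0) !big_ord_recl big_ord0 /cofactor.
by rewrite !det_mx22 !mxE !AE /= /bump /=; ring.
Qed.

Lemma tr_adj33 : \tr (\adj A) =
    (a 1%N 1%N * a 2%N 2%N - a 1%N 2%N * a 2%N 1%N)
  + (a 0%N 0%N * a 2%N 2%N - a 0%N 2%N * a 2%N 0%N)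
  + (a 0%N 0%N * a 1%N 1%N - a 0%N 1%N * a 1%N 0%N).
Proof.
rewrite /mxtrace !big_ord_recl big_ord0 !mxE /cofactor.
by rewrite !det_mx22 !mxE !AE /= /bump /=; ring.
Qed.

Lemma tr33 : \tr A = a 0%N 0%N + a 1%N 1%N + a 2%N 2%N.
Proof.
by rewrite /mxtrace !big_ord_recl big_ord0 !AE /= /bump /= addr0 addrA.
Qed.

End Matrix33.

(** Expansions produce many forms of the same ordinal; indices in [nat] compute to numerals, so
    [ring] and [lra] see just nine atoms. *)
Lemma mx33P (R : Type) (X : 'M[R]_3) :
  exists a : nat -> nat -> R, forall i j, X i j = a i j.
Proof.
by exists (fun k l => X (inord k) (inord l)) => i j; rewrite !inord_val.
Qed.

Lemma add1_mx33E (R : nzRingType) (X : 'M[R]_3) (a : nat -> nat -> R) :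
  (forall i j, X i j = a i j) ->
  forall i j, (1%:M + X) i j = (fun k l => (k == l)%:R + a k l) i j.
Proof. by move=> XE i j; rewrite !mxE XE. Qed.

(** The last three terms are the elementary symmetric functions of the eigenvalues of [X]. *)
Lemma det_add1_33 (R : comNzRingType) (X : 'M[R]_3) :
  \det (1%:M + X) = 1 + \tr X + \tr (\adj X) + \det X.
Proof.
have [a XE] := mx33P X.
rewrite (det_mx33 (add1_mx33E XE)) (det_mx33 XE) (tr33 XE) (tr_adj33 XE) /=.
ring.
Qed.

Lemma tr_adj_add1_33 (R : comNzRingType) (X : 'M[R]_3) :
  \tr (\adj (1%:M + X)) = 3 + 2 * \tr X + \tr (\adj X).
Proof.
have [a XE] := mx33P X.
rewrite (tr_adj33 (add1_mx33E XE)) (tr33 XE) (tr_adj33 XE) /=; ring.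
Qed.

(** * Scalar estimates in dimension three *)

Section Bounds33.
Variables (R : rcfType) (X : 'M[R]_3).
Let N := frob_norm X ^+ 2.

Lemma frob_norm33E (a : nat -> nat -> R) :
  (forall i j, X i j = a i j) ->
  frob_norm X ^+ 2 =
     a 0%N 0%N ^+ 2 + a 0%N 1%N ^+ 2 + a 0%N 2%N ^+ 2
  + (a 1%N 0%N ^+ 2 + a 1%N 1%N ^+ 2 + a 1%N 2%N ^+ 2)
  + (a 2%N 0%N ^+ 2 + a 2%N 1%N ^+ 2 + a 2%N 2%N ^+ 2).
Proof.
move=> XE; rewrite frob_normE !big_ord_recl !big_ord0 !XE /= /bump /=.
by rewrite !addr0 !addrA.
Qed.

(** Cauchy-Schwarz on the diagonal. *)
Lemma sqr_tr33_le : (\tr X) ^+ 2 <= 3 * N.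
Proof.
have [x XE] := mx33P X; rewrite /N (frob_norm33E XE) (tr33 XE).
move: (x 0 0)%N (x 0 1)%N (x 0 2)%N (x 1 0)%N (x 1 1)%N (x 1 2)%N (x 2 0)%N
  (x 2 1)%N (x 2 2)%N => a b c d e f g h i.
have := sqr_ge0 (a - e); have := sqr_ge0 (a - i); have := sqr_ge0 (e - i).
nra.
Qed.

(** Twice the right-hand side is [(tr X)^2 - tr (X^2)], and [tr (X^2) <= N]. *)
Lemma tr_adj33_ge : - (N / 2) <= \tr (\adj X).
Proof.
have [x XE] := mx33P X; rewrite /N (frob_norm33E XE) (tr_adj33 XE).
move: (x 0 0)%N (x 0 1)%N (x 0 2)%N (x 1 0)%N (x 1 1)%N (x 1 2)%N (x 2 0)%N
  (x 2 1)%N (x 2 2)%N => a b c d e f g h i.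
have := sqr_ge0 (a + e + i).
have := sqr_ge0 (b - d); have := sqr_ge0 (c - g); have := sqr_ge0 (f - h).
lra.
Qed.

Lemma tr_adj33_le : \tr (\adj X) <= N.
Proof.
have [x XE] := mx33P X; rewrite /N (frob_norm33E XE) (tr_adj33 XE).
move: (x 0 0)%N (x 0 1)%N (x 0 2)%N (x 1 0)%N (x 1 1)%N (x 1 2)%N (x 2 0)%N
  (x 2 1)%N (x 2 2)%N => a b c d e f g h i.
have := sqr_ge0 (a - e); have := sqr_ge0 (a - i); have := sqr_ge0 (e - i).
have := sqr_ge0 (b + d); have := sqr_ge0 (c + g); have := sqr_ge0 (f + h).
have := sqr_ge0 b; have := sqr_ge0 d; have := sqr_ge0 c.
have := sqr_ge0 g; have := sqr_ge0 f; have := sqr_ge0 h.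
lra.
Qed.

Lemma det33_ge : N <= 4 -> - N <= \det X.
Proof.
have [x XE] := mx33P X; rewrite /N (frob_norm33E XE) (det_mx33 XE).
move: (x 0 0)%N (x 0 1)%N (x 0 2)%N (x 1 0)%N (x 1 1)%N (x 1 2)%N (x 2 0)%N
  (x 2 1)%N (x 2 2)%N => a b c d e f g h i.
move=> N4.
(* [(p, q, r)] is the cross product of the last two rows, so the determinant is its dot product with
   the first row. Its squared norm is at most [s * t <= 4 * s]; expanding
   [|(a, b, c) + (p, q, r) / 2|^2 >= 0] then concludes. *)
pose p := e * i - f * h; pose q := f * g - d * i; pose r := d * h - e * g.
pose s := d ^+ 2 + e ^+ 2 + f ^+ 2; pose t := g ^+ 2 + h ^+ 2 + i ^+ 2.
have t4 : t <= 4.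
  have := sqr_ge0 a; have := sqr_ge0 b; have := sqr_ge0 c.
  have := sqr_ge0 d; have := sqr_ge0 e; have := sqr_ge0 f; rewrite /t; lra.
have s0 : 0 <= s by rewrite !addr_ge0 ?sqr_ge0.
have t0 : 0 <= t by rewrite !addr_ge0 ?sqr_ge0.
have st4 : s * t <= 4 * s by rewrite mulrC ler_wpM2r.
have lagrange :
    p ^+ 2 + q ^+ 2 + r ^+ 2 = s * t - (d * g + e * h + f * i) ^+ 2.
  by rewrite /p /q /r /s /t; ring.
have dgehfi := sqr_ge0 (d * g + e * h + f * i).
have := sqr_ge0 (a + p / 2); have := sqr_ge0 (b + q / 2).
have := sqr_ge0 (c + r / 2).
rewrite -/p -/q -/r -/s -/t.
clearbody p q r s t; lra.
Qed.

(** From [(tr X)^2 <= 3 N] and [N <= N^2 / 4]. *)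
Lemma tr33_le : 4 <= N -> \tr X <= Num.sqrt 3 / 2 * N.
Proof.
move=> N4; have s0 : 0 <= Num.sqrt 3 :> R by apply: sqrtr_ge0.
have s3 : Num.sqrt 3 ^+ 2 = 3 :> R by rewrite sqr_sqrtr.
have tN := sqr_tr33_le.
have y0 : 0 <= Num.sqrt 3 / 2 * N by apply: mulr_ge0; [lra | apply: sqr_ge0].
apply: le_trans (ler_norm _) _; rewrite -(ger0_norm y0) -ler_sqr ?nnegrE //.
rewrite !real_normK ?num_real // exprMn expr_div_n s3.
apply: le_trans tN _; move: N N4 {y0} => n n4.
have : 0 <= n * (n - 4) by rewrite mulr_ge0; lra.
lra.
Qed.

Lemma relative_bound33 :
  - ((1 + 3 / 2 * (1 + Num.sqrt 3)) * N) <=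
  Num.sg (\det (1%:M + X)) * \tr (\adj (1%:M + X) *m X) - \tr X.
Proof.
have s1 : 1 <= Num.sqrt 3 :> R by rewrite -[leLHS]sqrtr1 ler_wsqrtr // ler1n.
have N0 : 0 <= N by apply: sqr_ge0.
have sN : N <= Num.sqrt 3 * N by rewrite ler_peMl.
have t2 := sqr_tr33_le; have t4 := tr33_le.
have e1 := tr_adj33_ge; have e2 := tr_adj33_le; have d1 := det33_ge.
rewrite tr_adj_mul tr_adj_add1_33.
have detE := det_add1_33 X.
move: (Num.sqrt 3) (\tr X) (\tr (\adj X)) (\det X) (\det (1%:M + X)) N
  => s t e dX dB n in s1 N0 sN t2 t4 e1 e2 d1 detE *.
rewrite -mulr_natl.
case: (sgrP dB) => [dB0|dB0|dB0].
(* Zero determinant: only [- t] remains, and it equals [1 + e + dX]. *)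
- case: (leP n 4) => n4.
    by have := d1 n4; lra.
  by have := t4 (ltW n4); lra.
(* Positive determinant: for [n <= 4], [2 e + 3 dX >= - 4 n], and the constant is at least 4 because
   [1 <= s]. *)
- case: (leP n 4) => n4.
    by have := d1 n4; lra.
  (* The origin of the constant: [2 e + 3 dX > - 3 - 3 t - e], with [e <= n], [3 <= 3/2 n] and
     [3 t <= 3/2 s n]. *)
  by have := t4 (ltW n4); lra.
(* Negative determinant: the expression exceeds [3 + t + e]; the square and [t^2 <= 3 n] give
   [t >= - n - 3/4]. *)
- have := sqr_ge0 (t + 3 / 2); lra.
Qed.

End Bounds33.

(** * Dimension two and conclusion *)

(** For [det (1 + X)] positive, zero or negative, the right-hand side is [2 det X], [1 + det X], or
    [- 2 (tr X + det X) > 2]; and [2 det X >= - |X|^2]. *)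
Lemma relative_bound22 (R : rcfType) (X : 'M[R]_2) :
  - (1 * frob_norm X ^+ 2) <=
  Num.sg (\det (1%:M + X)) * \tr (\adj (1%:M + X) *m X) - \tr X.
Proof.
rewrite tr_adj_mul frob_normE /mxtrace !big_ord_recl !big_ord0 !det_mx22.
rewrite !mxE /cofactor !det_mx11 !mxE /=.
have -> : lift (lift ord0 ord0 : 'I_2) 0 = ord0 by apply: val_inj.
have -> : lift ord0 (0 : 'I_1) = ord_max :> 'I_2 by apply: val_inj.
move: (X ord0 ord0) (X ord0 ord_max) (X ord_max ord0) (X ord_max ord_max).
move=> a b c d; rewrite /bump /=.
set D := (_ - _ as X in Num.sg X).
have := sqr_ge0 (a + d); have := sqr_ge0 (b - c).
have := sqr_ge0 a; have := sqr_ge0 b; have := sqr_ge0 c; have := sqr_ge0 d.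
case: (sgrP D); rewrite /D; nra.
Qed.

Theorem lemma3p1 (R : realType) :
  (forall (M A : 'M[R]_2) (sigma : R),
     smallest_singular_value M sigma -> sigma != 0 ->
     frob_prod (Num.sg (\det A) *: cof A - Num.sg (\det M) *: cof M) (A - M)
       >= - (`|\det M| / sigma ^+ 2 * frob_norm (A - M) ^+ 2))
  /\
  (forall (M A : 'M[R]_3) (sigma : R),
     smallest_singular_value M sigma -> sigma != 0 ->
     frob_prod (Num.sg (\det A) *: cof A - Num.sg (\det M) *: cof M) (A - M)
       >= - ((1 + 3 / 2 * (1 + Num.sqrt 3)) * (`|\det M| / sigma ^+ 2)
             * frob_norm (A - M) ^+ 2)).
Proof.
split=> M A sigma sM s0; last first.
  apply: lower_bound_of_relative => //; last exact: relative_bound33.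
  by rewrite addr_ge0 // mulr_ge0 ?divr_ge0 ?addr_ge0 ?sqrtr_ge0.
rewrite -[_ / _]mul1r; apply: lower_bound_of_relative => //.
exact: relative_bound22.
Qed.
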